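(* Let $n\ge1$. For every $\mathcal M\subseteq \mathrm{GL}_n(\mathbb R)$, the group of matrices $\mathcal M'=\mathcal M(\mathcal F(\mathcal M))$ is the largest group in $\mathrm{GL}_n(\mathbb R)$ (with respect to inclusion) for which $\mathcal F(\mathcal M')=\mathcal F(\mathcal M)$. For every $\mathcal F\subseteq\mathcal C(\mathbb R)$, the family $\mathcal F'=\mathcal F(\mathcal M(\mathcal F))$ is the largest family of functions in $\mathcal C(\mathbb R)$ (with respect to inclusion) for which $\mathcal M(\mathcal F')=\mathcal M(\mathcal F)$.
   Context: $\mathcal C(\mathbb R)$ is the set of continuous functions $\mathbb R\to\mathbb R$. Each $f\in\mathcal C(\mathbb R)$ induces the point-wise map $\tilde f:\mathbb R^n\to\mathbb R^n$, $\tilde f(x_1,\dots,x_n)=(f(x_1),\dots,f(x_n))$. A matrix $M\in \mathrm{GL}_n(\mathbb R)$ commutes with $\tilde f$ if $\tilde f(Mv)=M\tilde f(v)$ for all $v\in\mathbb R^n$. For $\mathcal F\subseteq\mathcal C(\mathbb R)$, $\mathcal M(\mathcal F)$ is the set of all matrices in $\mathrm{GL}_n(\mathbb R)$ that commute with $\tilde f$ for every $f\in\mathcal F$ (it is a group under matrix multiplication). For $\mathcal M\subseteq \mathrm{GL}_n(\mathbb R)$, $\mathcal F(\mathcal M)$ is the set of all $f\in\mathcal C(\mathbb R)$ such that $\tilde f$ commutes with every $M\in\mathcal M$. *)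

(* Defs.v *)
(* MathComp / MathComp-Analysis *)
From HB Require Import structures.
From mathcomp Require Export all_boot all_order all_algebra.
From mathcomp Require Export all_classical all_reals topology normedtype.

Set Implicit Arguments.
Unset Strict Implicit.
Unset Printing Implicit Defensive.

Import GRing.Theory.
Export numFieldNormedType.Exports.

Local Open Scope ring_scope.
Local Open Scope classical_set_scope.

Definition continuous_functions (R : realType) : set (R -> R) :=
  [set f | continuous f].
Arguments continuous_functions R : clear implicits.

Definition GL (n : nat) (R : realType) : set 'M[R]_n :=
  [set A | A \in unitmx].
Arguments GL n R : clear implicits.

(* MathComp's {'GL_n[R]} requires a finite coefficient ring, hence this
   set-based rendering of "group in GL_n(R)". *)
Definition is_matrix_group (n : nat) (R : realType) (G : set 'M[R]_n) : Prop :=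
  [/\ G `<=` GL n R,
      G 1%:M,
      forall A B, G A -> G B -> G (A *m B)
    & forall A, G A -> G (invmx A)].

(* [map_mx f] on column vectors is the map
   (x_1, ..., x_n) |-> (f x_1, ..., f x_n). *)
Definition commutes_pointwise (n : nat) (R : realType)
    (A : 'M[R]_n) (f : R -> R) : Prop :=
  forall v : 'cV[R]_n, map_mx f (A *m v) = A *m map_mx f v.

Definition commuting_matrices (n : nat) (R : realType) (F : set (R -> R)) :
    set 'M[R]_n :=
  [set A | GL n R A /\ forall f, F f -> commutes_pointwise A f].
Arguments commuting_matrices n {R} F _.

Definition commuting_functions (n : nat) (R : realType) (M : set 'M[R]_n) :
    set (R -> R) :=
  [set f | continuous_functions R f /\
           forall A, M A -> commutes_pointwise A f].
Arguments commuting_functions {n R} M _.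

Definition is_largest (T : Type) (P : set T -> Prop) (A : set T) : Prop :=
  P A /\ forall B, P B -> B `<=` A.

(* Main.v *)
(* [commuting_matrices] and [commuting_functions] form an antitone Galois
   connection, so the closure of a set is the largest set with a given image;
   the closed sets of matrices are groups. *)
Require Import Defs.

Local Open Scope ring_scope.
Local Open Scope classical_set_scope.

(** Both operators reverse inclusion, and every set lies in its closure. Hence applying them three
    times equals applying one once, so the closure has the required image. If [M'] has the same
    image as [M], then [M'] lies in its own closure, which is that of [M]; likewise for
    functions. *)

Lemma commuting_matrices_group (n : nat) (R : realType) (F : set (R -> R)) :
  is_matrix_group (commuting_matrices n F).
Proof.
split=> [A [] //||A B [uA cA] [uB cB]|A [uA cA]].
- by split=> [|f _ v]; rewrite ?mul1mx //; exact: unitmx1.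
- split=> [|f Ff v]; first by rewrite /GL /= unitmx_mul; apply/andP.
  by rewrite -!mulmxA cA // cB.
- split=> [|f Ff v]; first by rewrite /GL /= unitmx_inv.
  (* Write [v] as [A] times [invmx A *m v], move [f] past [A], then cancel [A]. *)
  by rewrite -[in RHS](mulKVmx uA v) cA // mulKmx.
Qed.

Lemma commuting_functionsK (n : nat) (R : realType) (M : set 'M[R]_n) :
  M `<=` GL n R ->
  commuting_functions (commuting_matrices n (commuting_functions M)) =
  commuting_functions M.
Proof.
move=> MGL; apply/seteqP; split=> f [cf fM]; split=> // A.
- by move=> MA; apply: fM; split=> [|g [_]]; [exact: MGL | exact].
- by case=> _; apply.
Qed.

Lemma commuting_matricesK (n : nat) (R : realType) (F : set (R -> R)) :
  F `<=` continuous_functions R ->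
  commuting_matrices n (commuting_functions (commuting_matrices n F)) =
  commuting_matrices n F.
Proof.
move=> Fc; apply/seteqP; split=> A [uA AF]; split=> // f.
- by move=> Ff; apply: AF; split=> [|B [_]]; [exact: Fc | exact].
- by case=> _; apply.
Qed.

Theorem lemma1 (R : realType) (n : nat) (hn : (1 <= n)%N) :
  (forall M : set 'M[R]_n, M `<=` GL n R ->
     is_largest
       (fun M' : set 'M[R]_n =>
          is_matrix_group M' /\ commuting_functions M' = commuting_functions M)
       (commuting_matrices n (commuting_functions M)))
  /\
  (forall F : set (R -> R), F `<=` continuous_functions R ->
     is_largest
       (fun F' : set (R -> R) =>
          F' `<=` continuous_functions R /\
          commuting_matrices n F' = commuting_matrices n F)
       (commuting_functions (commuting_matrices n F))).
Proof.
split=> [M MGL|F Fc]; split.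
- by split; [exact: commuting_matrices_group | exact: commuting_functionsK].
(* Rewriting by equality of images leaves only that [G] lies in its own closure. *)
- move=> G [[GGL _ _ _] <-] A GA.
  by split=> [|f [_]]; [exact: GGL | exact].
- by split=> [f []//|]; exact: commuting_matricesK.
- move=> H [Hc <-] f Hf.
  by split=> [|A [_]]; [exact: Hc | exact].
Qed.
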